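(* Let $r\ge 2$ and $k\ge 3$ be given and let $\widehat{F}_k$ be an $r$-coloring of $K_k$ which is not monochromatic and whose pattern is different from the pattern $T_0$. Assume also that if $r=2$ then the pattern of $\widehat{F}_k$ is different from the pattern $P_2$. Then every $(r,\widehat{F}_k)$-extremal graph is a complete multipartite graph.
   Context: All graphs are finite and simple. An $r$-coloring of a graph is an arbitrary (not necessarily proper) assignment of colors from $\{1,\dots,r\}$ to its edges. The pattern of a colored graph is the partition of its edge set into color classes (color names are ignored). Given an $r$-coloring of a graph $G$, a copy of $\widehat{F}_k$ is a set of $k$ pairwise adjacent vertices of $G$ admitting a bijection to $V(K_k)$ under which two edges have the same color in $G$ iff their images have the same color in $\widehat{F}_k$. A coloring is $\widehat{F}_k$-free if it has no copy of $\widehat{F}_k$. $c_{r,\widehat{F}_k}(G)$ is the number of $\widehat{F}_k$-free $r$-colorings of $E(G)$, $c_{r,\widehat{F}_k}(n)$ its maximum over $n$-vertex graphs, and an $n$-vertex $G$ is $(r,\widehat{F}_k)$-extremal if $c_{r,\widehat{F}_k}(G)=c_{r,\widehat{F}_k}(n)$. The pattern $T_0$ is the coloring of the triangle $K_3$ in which two edges have one color and the third edge a different color. The pattern $P_2$ is the coloring of $K_4$ on vertices $a,b,c,d$ in which the edges $ac,bc,bd,cd$ have one color and the edges $ab,ad$ have a second color. *)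

(* Defs.v *)
From mathcomp Require Import all_boot.
Set Implicit Arguments. Unset Strict Implicit. Unset Printing Implicit Defensive.

Definition simple_graph (n : nat) (E : {set {set 'I_n}}) : bool :=
  [forall e in E, #|e| == 2].

(* An r-coloring of E(G): a finite function on subsets of vertices that is
   [Some color] exactly on the edges and [None] elsewhere; these are in
   bijection with the maps E(G) -> {1..r}. *)
Definition is_coloring (n r : nat) (E : {set {set 'I_n}})
  (c : {ffun {set 'I_n} -> option 'I_r}) : bool :=
  [forall e, (c e == None) == (e \notin E)].

Definition is_copy (n k r : nat) (E : {set {set 'I_n}})
  (c : {ffun {set 'I_n} -> option 'I_r}) (F : {set 'I_k} -> 'I_r)
  (phi : {ffun 'I_k -> 'I_n}) : bool :=
  injectiveb phi &&
  [forall x, forall y, (x != y) ==> ([set phi x; phi y] \in E)] &&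
  [forall x, forall y, forall u, forall v,
     ((x != y) && (u != v)) ==>
     ((F [set x; y] == F [set u; v]) ==
      (c [set phi x; phi y] == c [set phi u; phi v]))].

Definition F_free (n k r : nat) (E : {set {set 'I_n}})
  (c : {ffun {set 'I_n} -> option 'I_r}) (F : {set 'I_k} -> 'I_r) : bool :=
  ~~ [exists phi : {ffun 'I_k -> 'I_n}, is_copy E c F phi].

Definition count_free (n k r : nat) (E : {set {set 'I_n}})
  (F : {set 'I_k} -> 'I_r) : nat :=
  #|[set c : {ffun {set 'I_n} -> option 'I_r} | is_coloring E c && F_free E c F]|.

Definition extremal (n k r : nat) (E : {set {set 'I_n}}) (F : {set 'I_k} -> 'I_r)
  : Prop :=
  simple_graph E /\
  forall E' : {set {set 'I_n}}, simple_graph E' -> count_free E' F <= count_free E F.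

Definition complete_multipartite (n : nat) (E : {set {set 'I_n}}) : Prop :=
  exists p : 'I_n -> 'I_n,
    forall e : {set 'I_n},
      (e \in E) = [exists x, exists y, (e == [set x; y]) && (p x != p y)].

Definition same_pattern (k m : nat) (A B : eqType)
  (f : {set 'I_k} -> A) (g : {set 'I_m} -> B) : Prop :=
  exists phi : 'I_k -> 'I_m, bijective phi /\
    forall x y u v, x != y -> u != v ->
      (f [set x; y] == f [set u; v]) = (g [set phi x; phi y] == g [set phi u; phi v]).

Definition monochromatic (k r : nat) (F : {set 'I_k} -> 'I_r) : Prop :=
  forall x y u v : 'I_k, x != y -> u != v -> F [set x; y] = F [set u; v].

Definition T0 (e : {set 'I_3}) : bool := e == [set (inord 1 : 'I_3); inord 2].

Definition P2 (e : {set 'I_4}) : bool :=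
  (e == [set (inord 0 : 'I_4); inord 1]) || (e == [set (inord 0 : 'I_4); inord 3]).

(* Main.v *)
Require Import Defs.
From mathcomp Require Import all_boot perm.

(* Zykov symmetrization.  If u and v are nonadjacent, the number of F-free
   colorings of G is the sum, over the F-free colorings c of G - u - v, of
   f(c) g(c), where f and g count the extensions of c to u and to v.  Replacing u
   by a clone of v, or v by a clone of u, gives the sums of g^2 and f^2, so in an
   extremal graph f = g and the cloned graphs are extremal too.

   Suppose u and v, and v and w, are nonadjacent but u and w are adjacent.  By
   the above, an F-free coloring of G - v - w and its restriction to G - u - v - w
   have equally many extensions to w.  This fails when G - u - v - w has a single
   color o and the edges at u have a single, suitably chosen color i: every
   extension to w ignoring u can be completed with one fixed color j0 on uw, and
   some extension allows a second color j1.  Hence nonadjacency is transitive. *)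

Set Implicit Arguments. Unset Strict Implicit. Unset Printing Implicit Defensive.

Lemma eq_set2 (T : finType) (a b c d : T) :
  ([set a; b] == [set c; d]) = ((a == c) && (b == d)) || ((a == d) && (b == c)).
Proof.
apply/eqP/idP; last by case/orP=> /andP[/eqP-> /eqP->] //; rewrite setUC.
move/setP=> e; have := e a; have := e b; have := e c; have := e d.
rewrite !inE !eqxx ?orbT /= !(eq_sym c) !(eq_sym d).
by do 4![case: (_ == _)].
Qed.

(** * Patterns of colored cliques *)

Section Patterns.

Variables (k r : nat) (F : {set 'I_k} -> 'I_r).

(** [C] is a graph coloring seen through an embedding of the clique. Its values are options so that
    a coloring of a graph can be pulled back as it stands. *)
Definition realizes (C : 'I_k -> 'I_k -> option 'I_r) : Prop :=
  (forall x y, C x y = C y x) /\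
  forall x y u v, x != y -> u != v ->
    (F [set x; y] == F [set u; v]) = (C x y == C u v).

Definition star_frame (o i : 'I_r) (a : 'I_k) (C : 'I_k -> 'I_k -> option 'I_r) :=
  (forall x y, x != y -> x != a -> y != a -> C x y = Some o) /\
  (forall x, x != a -> C a x = Some i).

Definition pair_frame (o i j : 'I_r) (a b : 'I_k)
    (C : 'I_k -> 'I_k -> option 'I_r) : Prop :=
  [/\ a != b,
      forall x y, x != y -> x != a -> x != b -> y != a -> y != b -> C x y = Some o,
      forall x, x != a -> x != b -> C a x = Some i
    & C a b = Some j].

(** Deleting [b] makes the clique monochromatic, in a color that [b] also meets at [a]. Patterns
    without such a pair are the easy case of [flexible_exists]; those with one are split by the size
    of [k]. *)
Definition near_mono (a b : 'I_k) : Prop :=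
  a != b /\ forall x y, x != y -> x != b -> y != b -> F [set x; y] = F [set a; b].

Lemma fresh_vertex (s : seq 'I_k) : size s < k -> exists z, z \notin s.
Proof.
move=> szs; apply/existsP; apply: contraLR szs => s0.
rewrite -leqNgt -[X in X <= _]card_ord (leq_trans _ (card_size s)) //.
by apply: subset_leq_card; apply/subsetP=> x _; move/existsPn: s0 => /(_ x)/negPn.
Qed.

Lemma fresh_pair (s : seq 'I_k) :
  (size s).+1 < k -> exists z t, [/\ z != t, z \notin s & t \notin s].
Proof.
move=> szs; have [z zs] := fresh_vertex (ltnW szs).
have [|t] := @fresh_vertex (z :: s); first by [].
by rewrite inE negb_or eq_sym => /andP[zt ts]; exists z, t.
Qed.

Lemma near_mono_realizes a b C :
  near_mono a b -> realizes C ->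
  forall x y, x != y -> x != b -> y != b -> C x y = C a b.
Proof. by case=> ab abF [_ CP] x y xy xb yb; apply/eqP; rewrite -CP // abF. Qed.

(** [T0] and [P2] are boolean colorings, so a match amounts to a bijection and two distinct colors,
    [B] being the one where the pattern is true. *)
Lemma same_pattern2 (m : nat) (g : {set 'I_m} -> bool) (A B : 'I_r) (phi : 'I_k -> 'I_m) :
  bijective phi -> A != B ->
  (forall x y, x != y -> F [set x; y] = if g [set phi x; phi y] then B else A) ->
  same_pattern F g.
Proof.
move=> bphi AB Fg; exists phi; split=> // x y u v xy uv; rewrite !Fg //.
by case: (g _); case: (g _); rewrite ?eqxx ?(negPf AB) // eq_sym (negPf AB).
Qed.

Lemma near_mono_T0 a b : k = 3 -> near_mono a b -> ~ monochromatic F -> same_pattern F T0.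
Proof.
move=> k3 [ab abF] nmono.
have [|z] := @fresh_vertex [:: a; b]; first by rewrite /= k3.
rewrite !inE negb_or => /andP[za zb].
have all3 x : [|| x == a, x == b | x == z].
  apply: contraT; rewrite !negb_or => /and3P[xa xb xz].
  have : size [:: x; a; b; z] <= #|'I_k|.
    rewrite -(card_uniqP _) ?max_card //=.
    by rewrite !inE !negb_or xa xb xz ab (eq_sym a) za (eq_sym b) zb.
  by rewrite card_ord /= k3.
have az : F [set a; z] = F [set a; b] by rewrite abF // eq_sym.
have za' : F [set z; a] = F [set a; b] by rewrite setUC.
have ba : F [set b; a] = F [set a; b] by rewrite setUC.
have zb' : F [set z; b] = F [set b; z] by rewrite setUC.
have bz : F [set a; b] != F [set b; z].
  apply/negP=> /eqP bz; apply: nmono.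
  suff mono x y : x != y -> F [set x; y] = F [set a; b].
    by move=> x y u v xy uv; rewrite !mono.
  have := all3 x; have := all3 y.
  by do 2![case/or3P=> /eqP->]; rewrite ?eqxx ?az ?za' ?ba ?zb'.
(* The odd edge is bz, and [T0] singles out the edge 12. *)
pose phi x : 'I_3 := if x == a then inord 0 else if x == b then inord 1 else inord 2.
have phia : phi a = inord 0 by rewrite /phi eqxx.
have phib : phi b = inord 1 by rewrite /phi eqxx eq_sym (negPf ab).
have phiz : phi z = inord 2 by rewrite /phi (negPf za) (negPf zb).
apply: (@same_pattern2 3 T0 _ _ phi) bz _ => [|x y xy].
  apply: inj_card_bij; last by rewrite !card_ord k3.
  move=> x y; have := all3 x; have := all3 y.
  by do 2![case/or3P=> /eqP->]; rewrite ?phia ?phib ?phiz //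
    => /(congr1 val); rewrite /= !inordK.
rewrite /T0 eq_set2; have := all3 x; have := all3 y.
by case/or3P=> /eqP ey; case/or3P=> /eqP ex; move: xy; rewrite ex ey ?eqxx //
  ?phia ?phib ?phiz -!val_eqE /= !inordK.
Qed.

Lemma pattern_P2 (a b z t : 'I_k) : k = 4 -> uniq [:: a; b; z; t] ->
  F [set a; z] = F [set a; t] -> F [set a; z] != F [set a; b] ->
  F [set b; z] = F [set a; b] -> F [set b; t] = F [set a; b] ->
  F [set z; t] = F [set a; b] -> same_pattern F P2.
Proof.
move=> k4 U az_at az bz bt zt.
have all4 x : [|| x == a, x == b, x == z | x == t].
  have : x \in [:: a; b; z; t].
    apply: contraT => xU; have : size (x :: [:: a; b; z; t]) <= #|'I_k|.
      by rewrite -(card_uniqP _) ?max_card // cons_uniq xU.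
    by rewrite card_ord /= k4.
  by rewrite !inE.
move: U; rewrite /= !inE !negb_or andbT => /and3P[/and3P[ab naz nat] /andP[nbz nbt] nzt].
have ba : F [set b; a] = F [set a; b] by rewrite setUC.
have za : F [set z; a] = F [set a; z] by rewrite setUC.
have ta : F [set t; a] = F [set a; z] by rewrite setUC.
have zb : F [set z; b] = F [set a; b] by rewrite setUC.
have tb : F [set t; b] = F [set a; b] by rewrite setUC.
have tz : F [set t; z] = F [set a; b] by rewrite setUC.
(* [P2] has its second color on 01 and 03: [a] goes to 0, the far ends [z] and [t] of its odd edges
   to 1 and 3, and [b] to 2. *)
pose phi x : 'I_4 := if x == a then inord 0 else if x == b then inord 2
  else if x == z then inord 1 else inord 3.
have phia : phi a = inord 0 by rewrite /phi eqxx.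
have phib : phi b = inord 2 by rewrite /phi eqxx eq_sym (negPf ab).
have phiz : phi z = inord 1.
  by rewrite /phi eqxx eq_sym (negPf naz) eq_sym (negPf nbz).
have phit : phi t = inord 3.
  by rewrite /phi !(eq_sym t) (negPf nat) (negPf nbt) (negPf nzt).
rewrite eq_sym in az.
apply: (@same_pattern2 4 P2 _ _ phi) az _ => [|x y xy].
  apply: inj_card_bij; last by rewrite !card_ord k4.
  move=> x y; have := all4 x; have := all4 y.
  by do 2![case/or4P=> /eqP->]; rewrite ?phia ?phib ?phiz ?phit //
    => /(congr1 val); rewrite /= !inordK.
rewrite /P2 !eq_set2; have := all4 x; have := all4 y.
by case/or4P=> /eqP ey; case/or4P=> /eqP ex; move: xy; rewrite ex ey ?eqxx //
  ?phia ?phib ?phiz ?phit -!val_eqE /= !inordK.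
Qed.

(** * Colors that leave a choice on one edge *)

Lemma near_mono_star a b o i a' C : 4 <= k -> o != i ->
  near_mono a b -> realizes C -> star_frame o i a' C -> False.
Proof.
move=> k4 oi nm RC [inner star]; have CP := near_mono_realizes nm RC.
have oiE : Some o <> Some i by case=> /eqP; rewrite (negPf oi).
have [ab _] := nm; have symC := RC.1.
(* The edge zt has color [o] and avoids [b], so ab has color [o] as well. But either [b] is [a'] and
   ab has color [i], or a'z avoids [b] and has color [i]. *)
have [|z [t [zt]]] := @fresh_pair [:: a'; b]; first exact: k4.
rewrite !inE !negb_or => /andP[za zb] /andP[ta tb].
have := CP z t zt zb tb; rewrite inner //.
have [Ea|na] := eqVneq b a'; first by rewrite symC Ea star // -Ea.
by have := CP a' z; rewrite star // => <- //; rewrite eq_sym.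
Qed.

(* The frames describe F inside a graph colored o, except for the edges at u
   (color i), the edge uw and the edges at w; a and b are the preimages of u and w.
   So j0 on uw never creates a copy, and neither does j1 when w sends color m
   everywhere; the two star conditions make the colorings without w or without u
   F-free. *)
Definition flexible (o i j0 j1 m : 'I_r) : Prop :=
  [/\ j0 != j1,
      forall a C, realizes C -> star_frame o i a C -> False,
      forall a C, realizes C -> star_frame o m a C -> False,
      forall a b C, realizes C -> pair_frame o i j0 a b C -> False
    & forall a b C, realizes C -> pair_frame o i j1 a b C ->
        (forall z, z != a -> z != b -> C b z = Some m) -> False].

Lemma mono_star o a C : ~ monochromatic F -> realizes C -> star_frame o o a C -> False.
Proof.
move=> nmono [symC CP] [inner star]; apply: nmono => x y u v xy uv.
have E s t : s != t -> C s t = Some o.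
  move=> st; have [Es|sa] := eqVneq s a; first by rewrite Es star // -Es eq_sym.
  have [Et|ta] := eqVneq t a; first by rewrite symC Et star // -Et.
  exact: inner.
by apply/eqP; rewrite CP // !E.
Qed.

(** Here [i], [j0] and [m] are [o], so a copy through uw has only color [o] off [b]. With [j0] the
    edge ab has color [o] too; with [j1] the edge from [b] to any third vertex does. Either way some
    pair satisfies [near_mono]. *)
Lemma flexible_of_not_near_mono (o p : 'I_r) : 3 <= k -> o != p -> ~ monochromatic F ->
  (forall a b, ~ near_mono a b) -> flexible o o o p o.
Proof.
move=> k3 op nmono nnm.
have nearC a b C : realizes C -> a != b -> C a b = Some o ->
    (forall x y, x != y -> x != b -> y != b -> C x y = Some o) -> False.
  move=> [_ CP] ab Cab CE; apply: (nnm a b); split=> // x y xy xb yb.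
  by apply/eqP; rewrite CP // CE // Cab.
have offb j a b C : realizes C -> pair_frame o o j a b C ->
    forall x y, x != y -> x != b -> y != b -> C x y = Some o.
  move=> [symC CP] [ab inner str Cab] x y xy xb yb.
  have [Ex|xa] := eqVneq x a; first by rewrite Ex str // -Ex eq_sym.
  have [Ey|ya] := eqVneq y a; first by rewrite symC Ey str // -Ey.
  exact: inner.
have star a C := @mono_star o a C nmono.
split=> //.
  move=> a b C RC fr; apply: (nearC a b C) => //; first by case: fr.
    by case: fr.
  exact: offb fr.
move=> a b C RC fr Cb; have [|z] := @fresh_vertex [:: a; b]; first exact: k3.
rewrite !inE negb_or => /andP[za zb].
apply: (nearC z b C) => //; first by rewrite RC.1 Cb.
exact: offb fr.
Qed.

(** Here [i], [j0] and [m] are [p], and [j1] is [o]. Five vertices leave an edge zt of color [o] off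
    [b] and off the preimages of u and w. Hence [b] must be the preimage of u, whose edge to z has
    color [p]. With [j0] the edge ab then has color [p], not [o]; with [j1] and [m] the preimage of
    w would have to be [b] by the same argument. *)
Lemma flexible_ge5 a b (o p : 'I_r) : 5 <= k -> o != p -> near_mono a b ->
  flexible o p p o p.
Proof.
move=> k5 op nm.
have star := near_mono_star (ltnW k5) op nm.
have opE : Some o <> Some p by case=> /eqP; rewrite (negPf op).
have key a' b' c C : realizes C ->
    (forall x y, x != y -> x != a' -> x != b' -> y != a' -> y != b' -> C x y = Some o) ->
    (forall x, x != a' -> x != b' -> C a' x = Some p) -> c != a' -> b = c -> False.
  move=> RC inner star' ca bc; subst c; have CP := near_mono_realizes nm RC.
  have [|z [t [zt]]] := @fresh_pair [:: a'; b'; b]; first exact: k5.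
  rewrite !inE !negb_or => /and3P[za zb' zb] /and3P[ta tb' tb].
  have := CP z t zt zb tb; rewrite inner // -(CP a' z) ?star' //; by rewrite eq_sym.
split=> //; first by rewrite eq_sym.
- move=> a' b' C RC [ab' inner star' Cab].
  have [Eb|nb] := eqVneq b a'; last exact: (key a' b' b C).
  have CP := near_mono_realizes nm RC.
  have [|z [t [zt]]] := @fresh_pair [:: a'; b']; first exact: ltnW.
  rewrite !inE !negb_or => /andP[za zb'] /andP[ta tb'].
  have := CP z t zt; rewrite Eb za ta inner // => /(_ isT isT).
  rewrite RC.1; have [->|ab2] := eqVneq a b'; first by rewrite Cab.
  by rewrite star' // -Eb; case: nm.
- move=> a' b' C RC [ab' inner star' Cab] starb.
  have [Eb|nb] := eqVneq b a'; last exact: (key a' b' b C).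
  apply: (key b' a' b C) => //; last by rewrite Eb.
    by move=> x y xy xb xa yb ya; apply: inner.
  by move=> x xb xa; apply: starb.
Qed.

(* With a third color q the pattern P2 causes no trouble; for two colors one is
   forced to take q = o, which P2 obstructs. *)
Lemma flexible4 a b (o p q : 'I_r) : k = 4 -> o != p -> q != p ->
  ~ monochromatic F -> (q = o -> ~ same_pattern F P2) -> near_mono a b ->
  flexible o p q p o.
Proof.
move=> k4 op qp nmono nP2 nm.
have k4' : 4 <= k by rewrite k4.
have star := near_mono_star k4' op nm.
have opE : Some o <> Some p by case=> /eqP; rewrite (negPf op).
have [ab _] := nm.
have pE : Some p <> Some q by case=> /eqP; rewrite eq_sym (negPf qp).
(* If [b] is [b'], then zt and a'z avoid [b] and differ in color. Otherwise the triangle on [a'],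
   [b'] and the fourth vertex [t] avoids [b], yet a't has color [p] while a'b' has color [q] or b't
   has color [o]. *)
have core a' b' C j : realizes C -> pair_frame o p j a' b' C -> b != a' ->
    (forall z, z != a' -> z != b' -> C a' b' = Some p -> C b' z = Some o) ->
    j = p \/ j = q -> False.
  move=> RC [ab' inner star' Cab] ba' starb jpq; have CP := near_mono_realizes nm RC.
  have [Eb|bb'] := eqVneq b b'.
    have [|z [t [zt]]] := @fresh_pair [:: a'; b']; first exact: k4'.
    rewrite !inE !negb_or => /andP[za zb] /andP[ta tb].
    have := CP z t zt; rewrite Eb inner // => /(_ zb tb).
    by rewrite -Eb -(CP a' z) ?star' // ?Eb // eq_sym.
  have [|t] := @fresh_vertex [:: a'; b'; b]; first exact: k4'.
  rewrite !inE !negb_or => /and3P[ta tb' tb].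
  have := CP a' t; rewrite star' // eq_sym ta eq_sym ba' tb => /(_ isT isT isT).
  case: jpq => Ej; last first.
    by rewrite -(CP a' b') ?Cab ?Ej // 1?eq_sym.
  by rewrite -(CP b' t) ?starb ?Cab ?Ej // 1?eq_sym // => /esym.
split=> //; first by move=> a' C; apply: mono_star.
- move=> a' b' C RC fr; have [Eb|nb] := eqVneq b a'; last first.
    apply: (core a' b' C q) => //; last by right.
    by case: fr => _ _ _ -> z _ _ /esym.
  case: fr => ab' inner star' Cab; have CP := near_mono_realizes nm RC.
  have [|z [t [zt]]] := @fresh_pair [:: a'; b']; first exact: k4'.
  rewrite !inE !negb_or => /andP[za zb] /andP[ta tb].
  have := CP z t zt; rewrite Eb za ta inner // => /(_ isT isT).
  rewrite RC.1; have [Ea|ab2] := eqVneq a b'; last by rewrite star' // -Eb.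
  (* Only [q = o] survives, and then the edges from [a'] to [z] and [t] are the two odd edges of
     [P2]. *)
  rewrite Ea Cab; case=> oq; apply: nP2; first by rewrite oq.
  case: nm => _; rewrite Ea Eb (setUC [set b']) => nmF.
  apply: (@pattern_P2 a' b' z t) => //; try by apply: nmF; rewrite // eq_sym.
  + by rewrite /= !inE !negb_or ab' !(eq_sym a') !(eq_sym b') za ta zb tb zt.
  + by apply/eqP; rewrite RC.2 ?star' ?eqxx // eq_sym.
  + by rewrite RC.2 ?(eq_sym a' z) // Cab star' //; apply/eqP.
- move=> a' b' C RC fr starb; have [Eb|nb] := eqVneq b a'; last first.
    apply: (core a' b' C p) => //; last by left.
    by move=> z za zb _; apply: starb.
  case: fr => ab' inner star' Cab; have CP := near_mono_realizes nm RC.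
  have [|z [t [zt]]] := @fresh_pair [:: a'; b']; first exact: k4'.
  rewrite !inE !negb_or => /andP[za zb] /andP[ta tb].
  have := CP z t zt; rewrite Eb za ta inner // => /(_ isT isT).
  rewrite RC.1; have [Ea|ab2] := eqVneq a b'; first by rewrite Ea Cab.
  by rewrite star' // -Eb.
Qed.

Lemma flexible_exists : 2 <= r -> 3 <= k -> ~ monochromatic F -> ~ same_pattern F T0 ->
  (r = 2 -> ~ same_pattern F P2) -> exists o i j0 j1 m, flexible o i j0 j1 m.
Proof.
move=> r2 k3 nmono nT0 nP2.
pose o : 'I_r := Ordinal (ltnW r2); pose p : 'I_r := Ordinal r2.
have op : o != p by [].
have [/existsP[a /existsP[b ab]]|nm] := boolP [exists a, exists b,
    (a != b) && [forall x, forall y, [&& x != y, x != b & y != b] ==>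
      (F [set x; y] == F [set a; b])]]; last first.
  exists o, o, o, p, o; apply: flexible_of_not_near_mono => // a b [ab abF].
  move/existsPn/(_ a)/existsPn/(_ b): nm; rewrite ab /= => /negP; apply.
  by apply/forallP=> x; apply/forallP=> y; apply/implyP=> /and3P[xy xb yb]; rewrite abF.
have {ab}nm : near_mono a b.
  case/andP: ab => ab /forallP abF; split=> // x y xy xb yb.
  by have /forallP/(_ y) := abF x; rewrite xy xb yb => /eqP.
move: k3; rewrite leq_eqVlt => /orP[/eqP k3|].
  by case: nT0; apply: near_mono_T0 nm nmono; rewrite k3.
rewrite leq_eqVlt => /orP[/eqP k4|k5]; last by exists o, p, p, o, p; apply: flexible_ge5 nm.
have := r2; rewrite leq_eqVlt => /orP[/eqP E|r3].
  by exists o, p, o, p, o; apply: flexible4 nm => // _; apply: nP2.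
by exists o, p, (Ordinal r3), p, o; apply: flexible4 nm.
Qed.

End Patterns.

(** * Free colorings and their extensions *)

Section Extensions.

Variables (n k r : nat) (F : {set 'I_k} -> 'I_r).

Notation vertex := 'I_n.
Notation edges := {set {set 'I_n}}.
Notation coloring := {ffun {set 'I_n} -> option 'I_r}.

Implicit Types (E D : edges) (c : coloring) (u v w : vertex) (e : {set vertex}).

Definition pulled (c : coloring) (phi : 'I_k -> vertex) x y := c [set phi x; phi y].

(** Edges are read off [c] itself, so being a copy depends only on the values of [c] on pairs in the
    image. This lets copies pass between graphs. *)
Definition copy c (phi : 'I_k -> vertex) : Prop :=
  [/\ injective phi, forall x y, x != y -> c [set phi x; phi y] != None
    & realizes F (pulled c phi)].

Definition free_col E : {set coloring} := [set c | is_coloring E c && F_free E c F].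

Lemma free_colP E c :
  reflect ((forall e, (c e == None) = (e \notin E)) /\ (forall phi, ~ copy c phi))
          (c \in free_col E).
Proof.
rewrite inE; apply: (iffP andP) => -[cE free].
  have {}cE e : (c e == None) = (e \notin E) by move/forallP: cE => /(_ e)/eqP.
  split=> // phi [inj_phi phiE [_ phiF]]; case/negP: free.
  apply/existsP; exists (finfun phi); apply/andP; split; first (apply/andP; split).
  - by apply/injectiveP=> x y; rewrite !ffunE; apply: inj_phi.
  - apply/forallP=> x; apply/forallP=> y; apply/implyP=> xy; rewrite !ffunE.
    by have := phiE x y xy; rewrite cE negbK.
  - do 4![apply/forallP=> ?]; apply/implyP=> /andP[xy uv]; rewrite !ffunE.
    by apply/eqP/phiF.
split; first by apply/forallP=> e; rewrite cE.
apply/negP=> /existsP[phi /andP[/andP[/injectiveP inj_phi phiE] phiF]].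
apply: (free phi); split=> //.
  move=> x y xy; rewrite cE negbK.
  by have /forallP/(_ y)/implyP/(_ xy) := forallP phiE x.
split=> [x y|x y u v xy uv]; first by rewrite /pulled setUC.
by move/forallP/(_ x)/forallP/(_ y)/forallP/(_ u)/forallP/(_ v): phiF; rewrite xy uv => /eqP.
Qed.

Lemma copy_congr c c' phi : copy c phi ->
  (forall x y, x != y -> c' [set phi x; phi y] = c [set phi x; phi y]) -> copy c' phi.
Proof.
case=> inj_phi phiE [_ phiF] cc'; split=> // [x y xy|]; first by rewrite cc' // phiE.
split=> [x y|x y u v xy uv]; first by rewrite /pulled setUC.
by rewrite /pulled !cc' // phiF.
Qed.

Definition restr D c : coloring := [ffun e => if e \in D then c e else None].

Lemma restr_free_col E D c : D \subset E -> c \in free_col E -> restr D c \in free_col D.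
Proof.
move=> /subsetP DE /free_colP[cE free]; apply/free_colP; split=> [e|phi cp].
  by rewrite ffunE; case: ifP => // /DE eE; rewrite cE eE.
apply: (free phi); apply: (copy_congr cp) => x y xy.
by case: cp => _ /(_ x y xy) + _; rewrite !ffunE; case: ifP.
Qed.

Lemma restr_id E c : c \in free_col E -> restr E c = c.
Proof.
case/free_colP=> cE _; apply/ffunP=> e; rewrite ffunE; case: ifP => // /negbT.
by rewrite -cE => /eqP.
Qed.

Lemma restr_restr D D' c : D \subset D' -> restr D (restr D' c) = restr D c.
Proof.
move/subsetP=> DD; apply/ffunP=> e; rewrite !ffunE.
by case: ifP => // /DD->.
Qed.

(** The deleted vertex stays as an isolated one, so that all graphs share one vertex set and all
    colorings one type. *)
Definition del v E : edges := [set e in E | v \notin e].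

Lemma in_del v E e : (e \in del v E) = (e \in E) && (v \notin e).
Proof. by rewrite inE. Qed.

Lemma delC u v E : del u (del v E) = del v (del u E).
Proof. by apply/setP=> e; rewrite !in_del -!andbA [(u \notin e) && _]andbC. Qed.

Lemma del_sub v E : del v E \subset E.
Proof. by apply/subsetP=> e; rewrite in_del => /andP[]. Qed.

Definition extensions E D c0 : {set coloring} := [set c in free_col E | restr D c == c0].
Definition ext E D c0 : nat := #|extensions E D c0|.

Definition nonadj u v E : Prop := forall e, e \in E -> u \in e -> v \notin e.

Lemma nonadj_sym u v E : nonadj u v E -> nonadj v u E.
Proof. by move=> uv e eE ve; apply/negP=> /(uv e eE); rewrite ve. Qed.

Lemma nonadj_sub u v E D : D \subset E -> nonadj u v E -> nonadj u v D.
Proof. by move=> /subsetP DE uv e /DE; apply: uv. Qed.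

Lemma card_free_col_ext E D : D \subset E -> #|free_col E| = \sum_(c in free_col D) ext E D c.
Proof.
move=> DE; rewrite -sum1_card (partition_big (restr D) (mem (free_col D))) /=; last first.
  by move=> c; apply: restr_free_col.
apply: eq_bigr => c _; rewrite /ext -sum1_card; apply: eq_bigl => c'.
by rewrite [in RHS]inE.
Qed.

Definition glue D c1 c2 : coloring := [ffun e => if e \in D then c1 e else c2 e].

(** No clique holds both [u] and [v], so a copy in a glued coloring lies off [u] or off [v]. Hence
    extending [c1] to [v] amounts to choosing a free coloring of G - u that agrees with [c1] on G -
    u - v. *)
Lemma ext_nonadj E u v c1 : u != v -> nonadj u v E -> c1 \in free_col (del v E) ->
  ext E (del v E) c1 =
  ext (del u E) (del u (del v E)) (restr (del u (del v E)) c1).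
Proof.
move=> neq_uv uv c1g; rewrite /ext.
set D := del u (del v E); set B := extensions (del u E) D _.
have Dv : D \subset del v E by apply: del_sub.
have Du : D \subset del u E by rewrite /D delC del_sub.
have [c1E free1] := free_colP _ _ c1g.
have agree c2 : c2 \in B -> [/\ forall e, v \notin e -> glue (del v E) c1 c2 e = c1 e,
    forall e, u \notin e -> glue (del v E) c1 c2 e = c2 e & c2 \in free_col (del u E)].
  rewrite inE => /andP[c2g /eqP/ffunP c12].
  have [c2E _] := free_colP _ _ c2g; split=> // e ne; rewrite ffunE; case: ifP => // De.
    have De' : e \notin del u E by move: De; rewrite !in_del ne andbT => ->.
    have /eqP-> : c2 e == None by rewrite c2E.
    by apply/esym/eqP; rewrite c1E De.
  by have := c12 e; rewrite !ffunE /D in_del De ne.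
(* Gluing to [c1] is inverse to restricting to G - u. *)
rewrite -(card_in_imset (f := glue (del v E) c1) (D := B)); last first.
  move=> c2 c2' /agree[_ a2 c2g] /agree[_ a2' c2g'] /ffunP eq22.
  rewrite -(restr_id c2g) -(restr_id c2g'); apply/ffunP=> e; rewrite !ffunE in_del.
  by case: (boolP (u \in e)) => [|ue]; rewrite ?andbF // -a2 // -a2' // eq22.
apply: eq_card => c; apply/idP/imsetP => [|[c2 c2B ->]].
  rewrite inE => /andP[cg /eqP Ec1]; exists (restr (del u E) c).
    by rewrite inE (restr_free_col (del_sub _ _) cg) -Ec1 !restr_restr ?eqxx.
  rewrite -{1}(restr_id cg) -Ec1; apply/ffunP=> e; rewrite !ffunE !in_del.
  case: (boolP (e \in E)) => //= eE; case: (boolP (v \in e)) => //= ve.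
  by rewrite (nonadj_sym uv eE ve).
have [a1 a2 c2g] := agree c2 c2B; have [c2E free2] := free_colP _ _ c2g.
have gE e : (glue (del v E) c1 c2 e == None) = (e \notin E).
  have [ve|ve] := boolP (v \in e); last by rewrite a1 // c1E in_del ve andbT.
  have [ue|ue] := boolP (u \in e); last by rewrite a2 // c2E in_del ue andbT.
  rewrite ffunE in_del ve andbF c2E in_del ue andbF.
  by apply/esym/negP=> eE; have := uv e eE ue; rewrite ve.
rewrite inE; apply/andP; split.
  apply/free_colP; split=> // phi cp; have [_ phiE _] := cp.
  have [/existsP[a /eqP Ea]|/existsPn na] := boolP [exists a, phi a == u].
    apply: (free1 phi); apply: (copy_congr cp) => x y xy; rewrite a1 //.
    suff nv z : phi z != v by rewrite !inE negb_or !(eq_sym v) !nv.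
    apply/negP=> /eqP Ez; have az : a != z.
      by apply: contra_neq neq_uv => az; rewrite -Ea -Ez az.
    have := phiE a z az; rewrite gE negbK Ea Ez => eE.
    by have := uv _ eE; rewrite !inE !eqxx orbT => /(_ isT).
  apply: (free2 phi); apply: (copy_congr cp) => x y xy; rewrite a2 //.
  by rewrite !inE negb_or !(eq_sym u) !na.
rewrite -[X in _ == X](restr_id c1g); apply/eqP/ffunP=> e; rewrite !ffunE.
by case: (e \in _).
Qed.

(** Color G - v first. By [ext_nonadj] the number of extensions to [v] depends only on the
    restriction to G - u - v, and grouping by that restriction gives the products. *)
Lemma count_nonadj E u v : u != v -> nonadj u v E ->
  #|free_col E| = \sum_(c in free_col (del u (del v E)))
    ext (del v E) (del u (del v E)) c * ext (del u E) (del u (del v E)) c.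
Proof.
move=> neq_uv uv; set D := del u (del v E).
rewrite (card_free_col_ext (del_sub v E)).
under eq_bigr => c cg do rewrite (ext_nonadj neq_uv uv cg).
rewrite (partition_big (restr D) (mem (free_col D))) /=; last first.
  by move=> c; apply/restr_free_col/del_sub.
apply: eq_bigr => c _; rewrite -sum_nat_const; apply: eq_big => [c'|c'].
  by rewrite [in RHS]inE.
by case/andP=> _ /eqP->.
Qed.

(** * Cloning a vertex *)

Definition relabel u v e : {set vertex} := tperm u v @: e.

Lemma relabelK u v : involutive (relabel u v).
Proof.
move=> e; rewrite /relabel -imset_comp -[RHS]imset_id.
by apply: eq_imset => x /=; rewrite tpermK.
Qed.

Lemma mem_relabel u v e x : (x \in relabel u v e) = (tperm u v x \in e).
Proof. by rewrite -[in LHS](tpermK u v x) mem_imset //; apply: perm_inj. Qed.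

Lemma relabel_id u v e : u \notin e -> v \notin e -> relabel u v e = e.
Proof.
move=> ue ve; apply/setP=> x; rewrite mem_relabel.
by case: tpermP => [->|->|//]; rewrite (negPf ue) (negPf ve).
Qed.

Lemma relabel2 u v x y : relabel u v [set x; y] = [set tperm u v x; tperm u v y].
Proof. by rewrite /relabel imsetU !imset_set1. Qed.

Definition relabelc u v c : coloring := [ffun e => c (relabel u v e)].

Lemma relabelcK u v : involutive (relabelc u v).
Proof. by move=> c; apply/ffunP=> e; rewrite !ffunE relabelK. Qed.

Lemma relabel_free_col u v E E' c : (forall e, (e \in E') = (relabel u v e \in E)) ->
  c \in free_col E -> relabelc u v c \in free_col E'.
Proof.
move=> EE' /free_colP[cE free]; apply/free_colP; split=> [e|phi [inj_phi phiE RC]].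
  by rewrite ffunE cE EE'.
apply: (free (tperm u v \o phi)); split.
- by apply: inj_comp inj_phi; apply: perm_inj.
- by move=> x y xy; have := phiE x y xy; rewrite ffunE relabel2.
- split=> [x y|x y s t xy st]; first by rewrite /pulled setUC.
  by rewrite RC.2 // /pulled !ffunE !relabel2.
Qed.

(** Swapping [u] and [v] fixes every edge of [D], hence carries extensions of [c] to extensions of
    [c]. *)
Lemma ext_relabel u v E E' D : (forall e, (e \in E') = (relabel u v e \in E)) ->
  (forall e, e \in D -> (u \notin e) && (v \notin e)) ->
  forall c, ext E' D c = ext E D c.
Proof.
move=> EE' Duv c; rewrite /ext -(card_imset _ (inv_inj (relabelcK u v))).
have EE e : (e \in E) = (relabel u v e \in E') by rewrite EE' relabelK.
have rD c' : restr D (relabelc u v c') = restr D c'.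
  apply/ffunP=> e; rewrite !ffunE; case: ifP => // /Duv/andP[ue ve].
  by rewrite relabel_id.
apply: eq_card => c'; apply/imsetP/idP => [[c2 + ->]|].
  by case/setIdP=> c2g c2D; rewrite inE rD c2D (relabel_free_col EE c2g).
case/setIdP=> cg cD; exists (relabelc u v c'); last by rewrite relabelcK.
by rewrite inE rD cD (relabel_free_col EE' cg).
Qed.

(* It is v that becomes a copy of u. *)
Definition clone u v E : edges :=
  del v E :|: [set e | relabel u v e \in del v E].

Lemma in_clone u v E e : (e \in clone u v E) =
  (e \in E) && (v \notin e) || (relabel u v e \in E) && (u \notin e).
Proof. by rewrite !inE mem_relabel tpermR. Qed.

Section Clone.

Variables (u v : vertex) (E : edges).
Hypothesis neq_uv : u != v.

Lemma del_clone_r : del v (clone u v E) = del v E.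
Proof.
apply/setP=> e; rewrite !in_del in_clone ?mem_relabel ?tpermR.
case: (boolP (v \in e)) => ve; rewrite ?andbF //= !andbT.
case: (boolP (u \in e)) => ue; rewrite ?andbF ?orbF // relabel_id //.
by case: (e \in E).
Qed.

Lemma mem_del_clone_l e : (e \in del u (clone u v E)) = (relabel u v e \in del v E).
Proof.
rewrite !in_del in_clone ?mem_relabel ?tpermR.
case: (boolP (u \in e)) => ue; rewrite ?andbF //= !andbT.
case: (boolP (v \in e)) => ve; rewrite ?andbF ?andbT // relabel_id //.
by case: (e \in E).
Qed.

Lemma clone_nonadj : nonadj u v (clone u v E).
Proof.
move=> e; rewrite in_clone; case: (boolP (v \in e)) => // ve.
by rewrite andbF => /andP[_ /negPf->].
Qed.

Lemma clone_simple : simple_graph E -> simple_graph (clone u v E).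
Proof.
move=> /forall_inP sE; apply/forall_inP=> e; rewrite in_clone.
case/orP=> /andP[/sE]; first by [].
by rewrite card_imset //; apply: perm_inj.
Qed.

Lemma count_clone : nonadj u v E ->
  #|free_col (clone u v E)| = \sum_(c in free_col (del u (del v E)))
    ext (del v E) (del u (del v E)) c ^ 2.
Proof.
move=> uv; rewrite (count_nonadj neq_uv clone_nonadj) del_clone_r.
apply: eq_bigr => c _; rewrite -mulnn; congr (_ * _).
apply: (@ext_relabel u v) => e; first exact: mem_del_clone_l.
by rewrite !in_del -andbA => /and3P[_ -> ->].
Qed.

End Clone.

(** Extremality bounds the sums of f^2 and of g^2 by the sum of fg, while 2fg is at most f^2 + g^2
    in each term. So equality holds in each term, and the clone, counted by f^2, is extremal as
    well. *)
Lemma extremal_sym u v E : extremal E F -> u != v -> nonadj u v E ->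
  extremal (clone u v E) F /\
  forall c, c \in free_col (del u (del v E)) ->
    ext (del v E) (del u (del v E)) c = ext (del u E) (del u (del v E)) c.
Proof.
move=> [sE maxE] neq_uv uv; have vu := nonadj_sym uv.
have neq_vu : v != u by rewrite eq_sym.
have := maxE _ (clone_simple u v sE); have := maxE _ (clone_simple v u sE).
rewrite -![count_free _ F]/#|free_col _|.
rewrite (count_clone neq_uv uv) (count_clone neq_vu vu) (count_nonadj neq_uv uv) (delC v u).
set D := del u (del v E); set f := ext (del v E) D; set g := ext (del u E) D => le_g le_f.
have [le_fg eq_fg] := leqif_sum (fun c (_ : c \in free_col D) => nat_Cauchy (f c) (g c)).
move: le_fg eq_fg; rewrite -big_distrr big_split /= => le_fg eq_fg.
have eq2 : 2 * \sum_(c in free_col D) f c * g c =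
    \sum_(c in free_col D) f c ^ 2 + \sum_(c in free_col D) g c ^ 2.
  by apply/eqP; rewrite eqn_leq le_fg mul2n -addnn leq_add //.
have eqs : \sum_(c in free_col D) f c ^ 2 = \sum_(c in free_col D) f c * g c.
  apply/eqP; rewrite eqn_leq le_f /= -(leq_add2r (\sum_(c in free_col D) g c ^ 2)) -eq2.
  by rewrite mul2n -addnn leq_add2l.
split; last first.
  by move/esym: eq_fg; rewrite eq2 eqxx => /forall_inP fg c /fg/eqP.
split=> [|E' sE']; first exact: clone_simple.
rewrite (leq_trans (maxE _ sE')) //.
rewrite -![count_free _ F]/#|free_col _| (count_clone neq_uv uv) (count_nonadj neq_uv uv).
by rewrite eqs.
Qed.

(* Both sides count the extensions to v, which ignore u; for the right-hand side
   this is seen in the extremal graph where u has become a clone of v, so that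
   it is no longer adjacent to w. *)
Lemma ext_nonadj_trans u v w E c c2 : extremal E F -> u != v -> v != w -> u != w ->
  nonadj u v E -> nonadj v w E ->
  let K := del v E in let D := del u (del w K) in
  c \in free_col (del w K) -> c2 \in free_col (del w (del v (clone v u E))) ->
  restr D c2 = restr D c ->
  ext K (del w K) c = ext (del u K) D (restr D c).
Proof.
move=> extE neq_uv neq_vw neq_uw uv vw /= cg c2g c2c.
have neq_vu : v != u by rewrite eq_sym.
have [extE2 _] := extremal_sym extE neq_vu (nonadj_sym uv).
set E2 := clone v u E in c2g extE2.
have uE2 : del u E2 = del u E by exact: del_clone_r.
have uv2 : nonadj u v E2 by apply/nonadj_sym/clone_nonadj.
have vw2 : nonadj v w E2.
  move=> e eE2 ve; have : e \in del u E2 by rewrite in_del eE2 (nonadj_sym uv2).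
  by rewrite uE2 in_del => /andP[eE _]; apply: vw ve.
have uw2 : nonadj u w E2.
  move=> e; rewrite in_clone => /orP[/andP[_ /negPf->//]|/andP[reE _] ue].
  have := vw _ reE; rewrite !mem_relabel tpermL ue => /(_ isT).
  by rewrite tpermD.
have [_ sym1] := extremal_sym extE neq_vw vw.
have [_ sym2] := extremal_sym extE2 neq_vw vw2.
have c2g' : c2 \in free_col (del v (del w E2)) by rewrite delC.
have cg' : c \in free_col (del v (del w E)) by rewrite delC.
(* In [E2] both [v] and [w] are nonadjacent to [u], so the two equal counts of extensions of [c2]
   turn into counts over [D]. *)
have := sym2 c2 c2g'.
rewrite (ext_nonadj neq_uv (nonadj_sub (del_sub w E2) uv2) c2g').
rewrite [in X in _ = X -> _]delC (ext_nonadj neq_uw (nonadj_sub (del_sub v E2) uw2) c2g).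
have DE : del u (del w (del v E2)) = del u (del w (del v E)).
  by rewrite (delC u w) (delC u v) uE2 (delC v u) (delC w u).
rewrite (delC v w E2) DE (delC u w E2) uE2 (delC u v E2) uE2 c2c => sym2'.
(* In [E] the extensions of [c] to [w] are as many as those to [v], and only the latter are known to
   ignore [u]. *)
have := sym1 c cg'.
rewrite (ext_nonadj neq_uv (nonadj_sub (del_sub w E) uv) cg') (delC v w E) => <-.
by rewrite (delC u w E) sym2' (delC u v E).
Qed.

(** * More extensions across an edge *)

Definition star D x (o i : 'I_r) : coloring :=
  [ffun e => if e \in D then Some (if x \in e then i else o) else None].

(** A copy through [x] would realize a star frame, and a copy off [x] would be monochromatic. *)
Lemma star_free_col D x o i : ~ monochromatic F ->
  (forall a C, realizes F C -> star_frame o i a C -> False) ->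
  star D x o i \in free_col D.
Proof.
move=> nmono nstar; apply/free_colP; split=> [e|phi [inj_phi phiE RC]].
  by rewrite ffunE; case: (e \in D).
have val_phi s t : s != t -> pulled (star D x o i) phi s t =
    Some (if x \in [set phi s; phi t] then i else o).
  by move=> st; have := phiE s t st; rewrite /pulled ffunE; case: ifP.
have [/existsP[a /eqP Ea]|/existsPn na] := boolP [exists a, phi a == x].
  have nx s : s != a -> x == phi s = false by rewrite -Ea (inj_eq inj_phi) eq_sym => /negPf.
  apply: (nstar a _ RC); split=> [s t st sa ta|s sa].
    by rewrite val_phi // !inE !nx.
  by rewrite val_phi 1?eq_sym // !inE Ea eqxx.
have nx s : x == phi s = false by rewrite eq_sym (negPf (na s)).
apply: nmono => s t s' t' st st'; apply/eqP; rewrite RC.2 //.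
by rewrite !val_phi // !inE !nx.
Qed.

Section Adjacent.

Variables (u w : vertex) (K : edges) (o i : 'I_r).
Hypotheses (neq_uw : u != w) (uwK : [set u; w] \in K) (sK : simple_graph K).

Let c := star (del w K) u o i.
Let D := del u (del w K).

Hypothesis c_free_col : c \in free_col (del w K).

(** Extends [c] to [w]: [y] colors the edges at [w] other than uw, having been chosen without regard
    to [u], and uw receives [j]. *)
Definition join (j : 'I_r) (y : coloring) : coloring :=
  [ffun e => if e == [set u; w] then Some j else if w \in e then y e else c e].

Let Y := extensions (del u K) D (restr D c).

Lemma edge_uw e : e \in K -> u \in e -> w \in e -> e = [set u; w].
Proof.
move=> eK ue we; apply/esym/eqP; rewrite eqEcard subUset !sub1set ue we /=.
by rewrite cards2 neq_uw (eqP (forall_inP sK e eK)).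
Qed.

Lemma join_support j y e : y \in Y -> (join j y e == None) = (e \notin K).
Proof.
case/setIdP=> /free_colP[yE _] _; rewrite ffunE.
have [->|ne] := eqVneq e [set u; w]; first by rewrite uwK.
have [we|we] := boolP (w \in e); last first.
  by have /free_colP[-> _] := c_free_col; rewrite in_del we andbT.
rewrite yE in_del; have [eK|//] := boolP (e \in K) => /=.
by rewrite negbK; apply/negP=> ue; case/eqP: ne; apply: edge_uw.
Qed.

Lemma join_off_u j y e : y \in Y -> u \notin e -> join j y e = y e.
Proof.
case/setIdP=> /free_colP[yE _] /eqP/ffunP yc ue; rewrite ffunE.
have [Ee|_] := eqVneq e [set u; w]; first by rewrite Ee !inE eqxx in ue.
case: (boolP (w \in e)) => // we; have := yc e; rewrite !ffunE !in_del we ue !andbT.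
have [//|eK] := boolP (e \in K); move=> _; apply/esym/eqP.
by rewrite yE in_del negb_and eK.
Qed.

Lemma join_off_w j y e : w \notin e -> join j y e = c e.
Proof.
move=> we; rewrite ffunE (negPf we).
by case: eqVneq we => // ->; rewrite !inE eqxx orbT.
Qed.

Lemma join_inj j j' : {in Y &, forall y y', join j y = join j' y' -> y = y'}.
Proof.
move=> y y' yY yY' /ffunP eqj; apply/ffunP=> e.
have [ue|ue] := boolP (u \in e); last by have := eqj e; rewrite !join_off_u.
have none z : z \in Y -> z e = None.
  by case/setIdP=> /free_colP[zE _] _; apply/eqP; rewrite zE in_del ue andbF.
by rewrite !none.
Qed.

(* A copy must contain the edge uw, since c and y themselves are F-free. *)
Lemma copy_join j y phi : y \in Y -> copy (join j y) phi ->
  exists a b, pair_frame o i j a b (pulled (join j y) phi) /\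
    forall z, z != a -> z != b ->
      exists e, [/\ e \in del u K, w \in e & pulled (join j y) phi b z = y e].
Proof.
move=> yY cp; have [inj_phi phiE _] := cp; have /setIdP[/free_colP[yE freey] _] := yY.
have [cE freec] := free_colP _ _ c_free_col.
have [/existsP[a /eqP Ea]|/existsPn na] := boolP [exists a, phi a == u]; last first.
  case: (freey phi); apply: (copy_congr cp) => s t st; rewrite join_off_u //.
  by rewrite !inE negb_or !(eq_sym u) !na.
have [/existsP[b /eqP Eb]|/existsPn nb] := boolP [exists b, phi b == w]; last first.
  case: (freec phi); apply: (copy_congr cp) => s t st; rewrite join_off_w //.
  by rewrite !inE negb_or !(eq_sym w) !nb.
have nu s : s != a -> u == phi s = false by rewrite -Ea (inj_eq inj_phi) eq_sym => /negPf.
have nw s : s != b -> w == phi s = false by rewrite -Eb (inj_eq inj_phi) eq_sym => /negPf.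
have ab : a != b by apply: contra_neq neq_uw => ab; rewrite -Ea -Eb ab.
have inK s t : s != t -> [set phi s; phi t] \in K.
  by move=> st; have := phiE s t st; rewrite join_support // negbK.
exists a, b; split.
  split=> //.
  - move=> s t st sa sb ta tb; rewrite /pulled join_off_w ?inE ?nw // ffunE in_del inK //.
    by rewrite !inE !nw // !nu.
  - move=> s sa sb; have wu : w == u = false by rewrite eq_sym (negPf neq_uw).
    rewrite /pulled join_off_w ?inE ?Ea ?wu ?nw // ffunE in_del -{1}Ea inK 1?eq_sym //.
    by rewrite !inE wu nw // eqxx.
  - by rewrite /pulled Ea Eb ffunE eqxx.
move=> z za zb; exists [set phi b; phi z].
have ue : u \notin [set phi b; phi z] by rewrite !inE Eb (negPf neq_uw) nu.
split; last by rewrite /pulled join_off_u.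
  by rewrite in_del ue inK // eq_sym.
by rewrite !inE Eb eqxx.
Qed.

(** [join j0] injects [Y] into the extensions of [c]. Joining [y1] with [j1] gives one more, which
    differs from all of these on uw. *)
Lemma ext_adj_gt j0 j1 m : ~ monochromatic F -> flexible F o i j0 j1 m ->
  ext (del u K) D (restr D c) < ext K (del w K) c.
Proof.
move=> nmono [j01 nstar nstarm nj0 nj1].
have joinE j y : y \in Y -> (forall phi, ~ copy (join j y) phi) ->
    join j y \in extensions K (del w K) c.
  move=> yY free; rewrite inE; apply/andP; split.
    by apply/free_colP; split=> // e; apply: join_support.
  rewrite -[X in _ == X](restr_id c_free_col); apply/eqP/ffunP=> e; rewrite ![restr _ _ _]ffunE.
  by case: ifP => //; rewrite in_del => /andP[_ we]; rewrite join_off_w.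
(* All edges at [w] get [m], as the last clause of [flexible] requires; off [u] and [w] both [y1]
   and [c] are constantly [o]. *)
pose y1 := star (del u K) w o m.
have y1Y : y1 \in Y.
  rewrite inE star_free_col //; apply/eqP/ffunP=> e; rewrite !ffunE.
  case: ifP => // ; rewrite !in_del => /andP[/andP[-> we] ue].
  by rewrite ue we (negPf we) (negPf ue).
rewrite /ext -/Y -(card_in_imset (f := join j0) (D := Y)); last exact: join_inj.
have y1n : join j1 y1 \notin join j0 @: Y.
  apply/imsetP=> -[y _ /ffunP/(_ [set u; w])]; rewrite !ffunE eqxx => -[].
  by move/esym/eqP; rewrite (negPf j01).
have -> : #|join j0 @: Y|.+1 = #|join j1 y1 |: join j0 @: Y| by rewrite cardsU1 y1n.
apply/subset_leq_card/subsetP=> c' /setU1P[->|/imsetP[y yY ->]]; apply: joinE => // phi cp.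
  have [a [b [fr starb]]] := copy_join y1Y cp; have [_ _ RC] := cp.
  apply: (nj1 a b _ RC fr) => z za zb; have [e [eK we ->]] := starb z za zb.
  by rewrite ffunE eK we.
have [a [b [fr _]]] := copy_join yY cp; have [_ _ RC] := cp.
exact: (nj0 a b _ RC fr).
Qed.

End Adjacent.

(** * From transitivity of nonadjacency to the parts *)

Lemma nonadj_trans u v w E : 2 <= r -> 3 <= k -> ~ monochromatic F ->
  ~ same_pattern F T0 -> (r = 2 -> ~ same_pattern F P2) -> extremal E F ->
  u != v -> v != w -> u != w ->
  [set u; v] \notin E -> [set v; w] \notin E -> [set u; w] \notin E.
Proof.
move=> r2 k3 nmono nT0 nP2 extE neq_uv neq_vw neq_uw uvE vwE; apply/negP=> uwE.
have [sE _] := extE; have [o [i [j0 [j1 [m L]]]]] := flexible_exists r2 k3 nmono nT0 nP2.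
have nonadjE x y : x != y -> [set x; y] \notin E -> nonadj x y E.
  move=> xy xyE e eE xe; apply: contra xyE => ye.
  by rewrite -(edge_uw xy sE eE xe ye).
have uv := nonadjE u v neq_uv uvE; have vw := nonadjE v w neq_vw vwE.
have [_ nstar _ _ _] := L.
pose K := del v E; pose c := star (del w K) u o i.
have cg : c \in free_col (del w K) by apply: star_free_col.
(* Entirely of color [o], hence free because [F] is not monochromatic. It agrees with [c] off [u],
   whatever [i] is. *)
pose c2 := star (del w (del v (clone v u E))) u o o.
have c2g : c2 \in free_col (del w (del v (clone v u E))).
  by apply: star_free_col => // a C; apply: mono_star.
have sK : simple_graph K by apply/forall_inP=> e /setIdP[eE _]; apply: (forall_inP sE).
have uwK : [set u; w] \in K.
  by rewrite in_del uwE !inE negb_or (eq_sym v u) neq_uv neq_vw.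
have := ext_adj_gt neq_uw uwK sK cg nmono L.
rewrite (ext_nonadj_trans extE neq_uv neq_vw neq_uw uv vw cg c2g) ?ltnn //.
apply/ffunP=> e; rewrite !ffunE; case: ifP => //.
rewrite !in_del in_clone => /andP[/andP[/andP[-> ve] we] ue].
by rewrite ve we ue (negPf ue).
Qed.

End Extensions.

Theorem theorem1p2 (r k : nat) (F : {set 'I_k} -> 'I_r) :
  2 <= r -> 3 <= k ->
  ~ monochromatic F ->
  ~ same_pattern F T0 ->
  (r = 2 -> ~ same_pattern F P2) ->
  forall (n : nat) (E : {set {set 'I_n}}),
    extremal E F -> complete_multipartite E.
Proof.
move=> r2 k3 nmono nT0 nP2 n E extE; have [sE _] := extE.
pose nonedge x y := [set x; y] \notin E.
have nonedge_refl x : nonedge x x.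
  by apply/negP=> /(forall_inP sE); rewrite cards2 eqxx.
have nonedge_sym x y : nonedge x y = nonedge y x by rewrite /nonedge setUC.
have nonedge_trans x y z : nonedge x y -> nonedge y z -> nonedge x z.
  have [->//|xy] := eqVneq x y; have [->//|yz] := eqVneq y z.
  have [->//|xz] := eqVneq x z; exact: nonadj_trans extE xy yz xz.
(* A representative of the class of [x]. The default is never reached, since [nonedge x x] holds, so
   equivalent vertices get the same one. *)
pose p x := odflt x [pick z | nonedge x z].
have pP x : nonedge x (p x).
  by rewrite /p; case: pickP => [//|/(_ x)]; rewrite nonedge_refl.
have pE x y : (p x == p y) = nonedge x y.
  apply/eqP/idP => [pxy|xy].
    by apply: nonedge_trans (pP x) _; rewrite pxy nonedge_sym.
  have exy : nonedge x =1 nonedge y.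
    move=> z; apply/idP/idP; last exact: nonedge_trans.
    by apply: nonedge_trans; rewrite nonedge_sym.
  rewrite /p (eq_pick exy); case: pickP => // /(_ y).
  by rewrite nonedge_refl.
exists p => e; apply/idP/existsP => [eE|[x /existsP[y /andP[/eqP->]]]]; last first.
  by rewrite pE negbK.
have /cards2P[x [y [xy Ee]]] := forall_inP sE e eE.
by exists x; apply/existsP; exists y; rewrite Ee eqxx pE negbK -Ee.
Qed.
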